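(* Let $\mathcal{F}$ be an exponential family, let $n\ge 0$, let $x$ be a positive integer, $X=\{1,\dots,x\}$, and let $\mathcal{Z}=(z_0,z_1,z_2,\dots)$ be an interpolation grid such that $z_0\le z_1\le\cdots\le z_{n-1}$ are integers in $X$. Then $$t_n(0;\mathbf{y},\mathcal{F},-\mathcal{Z}) = t_n(x;\mathbf{y},\mathcal{F},x-\mathcal{Z}) = \sum_{H\text{ of weight } n}\mathrm{type}(H)\cdot PF_H(\mathcal{Z}),$$ where $H$ ranges over all hands of weight $n$ in $\mathcal{F}$, $-\mathcal{Z}=(-z_0,-z_1,\dots)$, $x-\mathcal{Z}=(x-z_0,x-z_1,\dots)$, and by convention the third term equals $1$ when $n=0$.
   Context: Let $\mathbb{K}$ be a field of characteristic zero (e.g. $\mathbb{Q}$, $\mathbb{R}$ or $\mathbb{C}$); an interpolation grid is a sequence $(z_i)_{i\ge0}$ of elements of $\mathbb{K}$. Write $[n]=\{1,\dots,n\}$. Exponential families: given an abstract set $P$ of ''pictures'', a card is a pair $\mathcal{C}(S,p)$ of a finite nonempty set $S$ of positive integers (its label set) and a picture $p\in P$; its weight is $|S|$. A card is standard if $S=[m]$ for some $m$. An exponential family $\mathcal{F}$ is a collection of decks $\mathcal{D}_1,\mathcal{D}_2,\dots$, where $\mathcal{D}_m$ is a finite set of standard cards of weight $m$ (the $m$-th deck). The cards of $\mathcal{F}$ are all relabelings of cards in the decks, i.e. all $\mathcal{C}(S,p)$ with $\mathcal{C}([m],p)\in\mathcal{D}_m$, $m=|S|$. A hand of weight $n$ is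 a set of cards of $\mathcal{F}$ whose label sets form a set partition of $[n]$. Type enumerator: let $y_1,y_2,\dots$ be free variables, $\mathbf{y}=(y_1,y_2,\dots)$. For a hand $H=\{\mathcal{C}_1,\dots,\mathcal{C}_k\}$ whose cards have weights $t_1,\dots,t_k$, $\mathrm{type}(H)=y_{t_1}y_{t_2}\cdots y_{t_k}$. Define $h_0(x;\mathbf{y})=1$ and, for $n\ge1$, the polynomial in $x$ $$h_n(x;\mathbf{y})=\sum_{H\text{ of weight }n}\mathrm{type}(H)\,x^{|H|},$$ where $|H|$ is the number of cards of $H$ (so for a positive integer $x$, $x^{|H|}$ is the number of functions from the cards of $H$ to $\{1,\dots,x\}$). Generalized Gončarov polynomials: for any grid $\mathcal{U}=(u_0,u_1,\dots)$, the polynomials $t_n(x;\mathbf{y},\mathcal{F},\mathcal{U})$, $n\ge0$, are defined recursively by $$t_n(x;\mathbf{y},\mathcal{F},\mathcal{U})=h_n(x;\mathbf{y})-\sum_{i=0}^{n-1}\binom{n}{i}h_{n-i}(u_i;\mathbf{y})\,t_i(x;\mathbf{y},\mathcal{F},\mathcal{U}).$$ Parking functions: with $\vec z=(z_0,\dots,z_{n-1})$, a sequence $(x_1,\dots,x_n)$ of positive integers is a $\vec z$-parking function if its nondecreasing rearrangement $x_{(1)}\le\cdots\le x_{(n)}$ satisfies $x_{(i)}\le z_{i-1}$ for $i=1,\dots,n$. For a hand $H$ of weight $n$ and a function $f:H\to X$ from the cards of $H$ to $X$, let $f_H=(x_1,\dots,x_n)$ where $x_i=f(\mathcal{C})$ for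 the card $\mathcal{C}\in H$ whose label set contains $i$. $PF_H(\mathcal{Z})$ is the number of functions $f:H\to X$ such that $f_H$ is a $\vec z$-parking function. *)

(* Defs.v *)
From mathcomp Require Import all_boot all_order all_algebra.
From mathcomp Require Import finmap.
From mathcomp Require Import monalg.

Set Implicit Arguments.
Unset Strict Implicit.
Unset Printing Implicit Defensive.

Import GRing.Theory.
Local Open Scope fset_scope.

Definition interval1 (n : nat) : {fset nat} := [fset i in iota 1 n].

Lemma in_interval1 n i : (i \in interval1 n) = (0 < i <= n).
Proof. by rewrite inE /= mem_iota add1n ltnS. Qed.

Lemma card_interval1 n : #|` interval1 n| = n.
Proof.
by rewrite card_fseq undup_id ?size_iota // iota_uniq.
Qed.

Lemma interval1_0 : interval1 0 = fset0.
Proof. by apply/fsetP => i; rewrite in_interval1 inE; case: i. Qed.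

(* A pair (S, p); that S is a nonempty set of positive integers is imposed by
   the predicates below. *)
Notation pcard P := ({fset nat} * P)%type.

Definition label (P : choiceType) (c : pcard P) : {fset nat} := c.1.
Definition picture (P : choiceType) (c : pcard P) : P := c.2.
Definition weight (P : choiceType) (c : pcard P) : nat := #|` label c|.

(* The decks are D_1, D_2, ...; the index 0 carries no cards. *)
Record exp_family (P : choiceType) := ExpFamily {
  deck : nat -> {fset pcard P};
  deck_standard : forall m c, c \in deck m -> label c = interval1 m;
  deck0 : deck 0 = fset0
}.

Section ExponentialFamily.
Variables (P : choiceType) (F : exp_family P).
Implicit Types (c d : pcard P) (H : {fset pcard P}) (n : nat).

Definition is_card c : bool :=
  [&& label c != fset0, 0 \notin label c &
      (interval1 (weight c), picture c) \in deck F (weight c)].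

Definition is_hand n H : bool :=
  [&& [forall c : H, is_card (val c)],
      [forall c : H, [forall d : H,
         (c != d) ==> [disjoint label (val c) & label (val d)]%fset]] &
      \bigcup_(c <- H) label c == interval1 n].

Definition cards_within n : {fset pcard P} :=
  [fset (S, picture c) | S in fpowerset (interval1 n), c in deck F #|` S|].

(* The ambient powerset only makes the collection finite, see [in_hands]. *)
Definition hands n : {fset {fset pcard P}} :=
  [fset H in fpowerset (cards_within n) | is_hand n H].

Lemma in_cards_within n c :
  (c \in cards_within n) = is_card c && (label c `<=` interval1 n).
Proof.
apply/imfset2P/andP => [[S /= Sn [d dD ->]]|[/and3P[c0 cP cD] cn]].
  rewrite fpowersetE in Sn; split=> //; apply/and3P; split=> /=.
  - apply: contraTneq dD => /= ->; rewrite cardfs0 deck0 //.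
  - by apply/negP=> /(fsubsetP Sn); rewrite in_interval1.
  - by rewrite /weight /= -(deck_standard dD); case: d dD.
exists (label c); first by rewrite /= fpowersetE.
by exists (interval1 (weight c), picture c) => //; case: (c).
Qed.

Lemma in_hands n H : (H \in hands n) = is_hand n H.
Proof.
rewrite !inE /= fpowersetE andb_idl // => /and3P[/forallP Hc _ /eqP Hn].
apply/fsubsetP => c cH; rewrite in_cards_within (Hc [` cH]) /= -Hn.
exact: bigfcup_sup.
Qed.

Lemma hands0 : hands 0 = [fset fset0].
Proof.
apply/fsetP => H; rewrite in_hands !inE; apply/idP/eqP => [|->]; last first.
  apply/and3P; split; first by apply/forallP => -[].
    by apply/forallP => -[].
  by rewrite big_seq_fset0 interval1_0.
move=> /and3P[/forallP Hc _ /eqP Hn]; apply/fsetP => c; rewrite inE.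
apply/negP => cH; have /and3P[+ _ _] := Hc [` cH]; apply/negP; rewrite negbK /=.
have : label c `<=` \bigcup_(d <- H) label d by exact: bigfcup_sup.
by rewrite Hn interval1_0 fsubset0.
Qed.

End ExponentialFamily.

Local Open Scope ring_scope.

(* K[y_0, y_1, y_2, ...]; cards having positive weight, y_0 is never used. *)
Notation ypoly K := {malg K[{cmonom nat}]}.

Definition yvar (K : fieldType) (t : nat) : ypoly K := << ucm t >>.

Definition hand_type (K : fieldType) (P : choiceType) (H : {fset pcard P}) :
  ypoly K := \prod_(c <- H) yvar K (weight c).

Section Goncarov.
Variables (K : fieldType) (P : choiceType) (F : exp_family P).

Definition type_enum (n : nat) : {poly ypoly K} :=
  \sum_(H <- hands F n) hand_type K H *: 'X^#|` H|.

Lemma type_enum0 : type_enum 0 = 1.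
Proof.
rewrite /type_enum hands0 big_seq_fset1 cardfs0 expr0.
by rewrite /hand_type big_seq_fset0 scale1r.
Qed.

Variable U : nat -> K.

Definition goncarov_step (n : nat) (t : nat -> {poly ypoly K}) :
    {poly ypoly K} :=
  type_enum n -
    \sum_(i < n) ('C(n, i)%:R * (type_enum (n - i)).[(U i)%:MP]) *: t i.

(* [:: t_0; ...; t_(n-1)] *)
Fixpoint goncarov_seq (n : nat) : seq {poly ypoly K} :=
  if n is m.+1 then
    let s := goncarov_seq m in rcons s (goncarov_step m (nth 0 s))
  else [::].

Definition goncarov (n : nat) : {poly ypoly K} := nth 0 (goncarov_seq n.+1) n.

Lemma size_goncarov_seq n : size (goncarov_seq n) = n.
Proof. by elim: n => //= n IHn; rewrite size_rcons IHn. Qed.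

Lemma nth_goncarov_seq n i : (i < n)%N -> nth 0 (goncarov_seq n) i = goncarov i.
Proof.
elim: n => // n IHn; rewrite ltnS leq_eqVlt => /predU1P[->//|ltin].
by rewrite /= nth_rcons size_goncarov_seq ltin IHn.
Qed.

Lemma goncarovE n :
  goncarov n = type_enum n -
    \sum_(i < n)
      ('C(n, i)%:R * (type_enum (n - i)).[(U i)%:MP]) *: goncarov i.
Proof.
rewrite {1}/goncarov /= nth_rcons size_goncarov_seq ltnn eqxx.
congr (_ - _); apply: eq_bigr => i _; by rewrite nth_goncarov_seq.
Qed.

End Goncarov.

Local Open Scope nat_scope.

(* [tnth z i] is z_i, and the other side of the comparison is x_(i+1). *)
Definition is_parking (n : nat) (z s : n.-tuple nat) : bool :=
  all (ltn 0) s &&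
  [forall i : 'I_n, tnth [tuple of sort leq s] i <= tnth z i].

Section ParkingFunctions.
Variables (P : choiceType) (n x : nat) (H : {fset pcard P}).

(* Value of f at the card whose label set contains i; this card exists and is
   unique when H is a hand of weight n and 1 <= i <= n. *)
Definition card_value (f : {ffun H -> interval1 x}) (i : nat) : nat :=
  oapp (fun c => val (f c)) 0 [pick c : H | i \in label (val c)].

Definition hand_seq (f : {ffun H -> interval1 x}) : n.-tuple nat :=
  [tuple card_value f i.+1 | i < n].

Definition PF (z : n.-tuple nat) : nat :=
  #|[set f : {ffun H -> interval1 x} | is_parking z (hand_seq f)]|.

End ParkingFunctions.

Local Open Scope ring_scope.

(* The n = 0 case of the sum follows the convention that it equals 1. *)
Lemma sum_PF0 (K : fieldType) (P : choiceType) (F : exp_family P) (x : nat)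
    (z : 0.-tuple nat) :
  \sum_(H <- hands F 0) hand_type K H * (PF x H z)%:R = 1.
Proof.
rewrite hands0 big_seq_fset1 /hand_type big_seq_fset0 mul1r /PF.
set A := finset _; suff -> : A = setT.
  by rewrite cardsT card_ffun -!cardfE cardfs0 expn0.
apply/setP => f; rewrite !inE; apply/andP; split; first by rewrite tuple0.
by apply/forallP => -[].
Qed.

(* Main.v *)
Require Import Defs.
From mathcomp Require Import all_boot all_order all_algebra.
From mathcomp Require Import finmap.
From mathcomp Require Import monalg.

Set Implicit Arguments.
Unset Strict Implicit.
Unset Printing Implicit Defensive.

Import GRing.Theory.
Local Open Scope ring_scope.

(** Write h_n for the type enumerator, w_m = h_m(1), and p_n for the sum over
    the hands H of weight n of type(H) PF_H(Z).  The theorem follows from one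
    identity: for every r in K,
      h_n(r) = sum_(i <= n) C(n, i) h_(n-i)(r - z_i) p_i.
    Its term i = n is p_n, because h_0 = 1; so it is the recursion that defines
    the value at r of the Goncarov polynomials of the grid r - Z, and these
    values are the p_i ([goncarov_parking]).  The two sides of the theorem are
    the cases r = 0 and r = x.

    Both sides of the identity are polynomials in r and the p_i do not depend on
    the size of the ambient set of values, since the values of a parking function
    are bounded by the largest z_i ([PF_widen]).  In characteristic zero it is
    therefore enough to prove the identity when r is a large natural number x
    ([poly_eq0_of_natr]), where h_n(x) enumerates the pairs of a hand H and a
    function from its cards to [x] ([type_enum_parking]).

    A function on the cards of H is the same thing as a colouring of the labels
    that is constant on each card.  For a fixed colouring, the hands all of whose
    cards are monochromatic have total type the product, over the colours, of
    w_m with m the number of labels of that colour ([mono_enum_prod]).  So both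
    h_n(x) and p_n are sums of such weights over colourings of [n]
    ([sum_hands_colourings], [type_enum_colourings]), and hands disappear.

    What is left is a classical argument on a colouring with colours 1, ..., x.
    Let i be the least index with at most i labels of colour at most z_i.  Then
    exactly i labels have colour at most z_i; on them the colouring is parking
    for z_0, ..., z_(i-1), and the other n - i labels have colours in
    (z_i, x], a set of x - z_i colours.  This decomposition is unique
    ([exists_cut]) and multiplicative for the weights, because the two sets of
    labels share no colour ([cut_weight]); summing gives the identity
    ([sum_colouring_decomp]). *)

(** * Hands with monochromatic cards *)

Section MonochromaticHands.
Local Open Scope nat_scope.
Local Open Scope fset_scope.
Variables (P : choiceType) (F : exp_family P) (C : eqType).
Implicit Types (A B S : {fset nat}) (H : {fset pcard P}) (k : nat -> C).

Definition hand_on A H : bool :=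
  [&& all (is_card F) H,
      all (fun c => all (fun d =>
        (c == d) || [disjoint label c & label d]%fset) H) H &
      \bigcup_(c <- H) label c == A].

Definition monochrome k (c : pcard P) : bool :=
  all (fun i => all (fun j => k i == k j) (label c)) (label c).

(** The ambient powerset only makes the collection finite: a hand on A uses cards
    with labels between 1 and the largest element of A. *)
Definition mono_hands k A : {fset {fset pcard P}} :=
  [fset H in fpowerset (cards_within F (\max_(a <- A) a)) |
     hand_on A H && all (monochrome k) H].

Definition fiber k A (x : C) : {fset nat} := [fset a in A | k a == x].

Lemma hand_onP A H :
  reflect [/\ forall c, c \in H -> is_card F c /\ (label c `<=` A),
      forall c d a, c \in H -> d \in H -> a \in label c -> a \in label d -> c = d
    & forall a, a \in A -> exists2 c, c \in H & a \in label c]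
    (hand_on A H).
Proof.
apply: (iffP and3P) => [[/allP Hc /allP Hd /eqP HA]|[Hc Hd HA]].
  split=> [c cH|c d a cH dH ac ad|a].
  - by split; [exact: Hc | rewrite -HA bigfcup_sup].
  - have /allP/(_ d dH)/orP[/eqP//|/fdisjointP/(_ a ac)] := Hd c cH.
    by rewrite ad.
  by rewrite -HA => /bigfcupP[c]; rewrite andbT => cH ac; exists c.
split.
- by apply/allP => c /Hc[].
- apply/allP => c cH; apply/allP => d dH; case: eqVneq => //= cd.
  apply/fdisjointP => a ac; apply: contraNN cd => ad.
  by rewrite (Hd c d a).
apply/eqP/fsetP => a; apply/bigfcupP/idP => [[c]|/HA[c cH ac]].
  by rewrite andbT => /Hc[_ /fsubsetP sub] /sub.
by exists c; rewrite ?cH.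
Qed.

Lemma is_handE n H : is_hand F n H = hand_on (interval1 n) H.
Proof.
rewrite /is_hand /hand_on; congr [&& _, _ & _].
  apply/forallP/allP => [Hc c cH|Hc c]; first exact: (Hc [` cH]).
  by apply: Hc; exact: valP.
apply/forallP/allP => [Hc c cH|Hc c].
  apply/allP => d dH; have /forallP/(_ [` dH]) := Hc [` cH].
  by rewrite -(inj_eq val_inj) /= implyNb.
apply/forallP => d; have /allP/(_ _ (valP d)) := Hc _ (valP c).
by rewrite -(inj_eq val_inj) /= implyNb.
Qed.

Lemma monochromeP k c :
  reflect (forall i j, i \in label c -> j \in label c -> k i = k j)
    (monochrome k c).
Proof.
apply: (iffP allP) => [kc i j ic jc|kc i ic].
  by have /allP/(_ j jc)/eqP := kc i ic.
by apply/allP => j jc; rewrite (kc i j).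
Qed.

Lemma in_mono_hands k A H :
  (H \in mono_hands k A) = hand_on A H && all (monochrome k) H.
Proof.
rewrite !inE /= fpowersetE andb_idl // => /andP[/hand_onP[Hc _ _] _].
apply/fsubsetP => c /Hc[cF /fsubsetP cA]; rewrite in_cards_within cF.
apply/fsubsetP => a ac; rewrite in_interval1 lt0n.
apply/andP; split; last by apply: leq_bigmax_seq => //; exact: cA.
by apply: contraTneq cF => a0; rewrite /is_card -a0 ac andbF.
Qed.

(** Hands without colour condition are those for a constant colouring, so that
    what is proved for monochromatic hands also applies to [hands]. *)
Lemma mono_hands_interval (k : nat -> C) n : (forall i j, k i = k j) ->
  mono_hands k (interval1 n) = hands F n.
Proof.
move=> kC; apply/fsetP => H; rewrite in_mono_hands in_hands is_handE andb_idr //.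
by move=> _; apply/allP => c _; apply/monochromeP.
Qed.

(** The cards through the label a whose other labels lie in B.  They are listed by
    label set, which makes sums over them sums over subsets of B. *)
Definition cards_at a B : seq (pcard P) :=
  [seq (a |` E, picture c) | E <- fpowerset B, c <- deck F #|` E|.+1].

Lemma cards_atP a B (c : pcard P) : 0 \notin a |` B -> a \notin B ->
  (c \in cards_at a B) = [&& is_card F c, a \in label c & label c `<=` a |` B].
Proof.
move=> B0 aB; apply/allpairsPdep/and3P => [[S [d [/= SB dD ->]]]|[cF ac cB]].
  rewrite fpowersetE in SB.
  have aS : a \notin S by apply: contraNN aB; exact/fsubsetP.
  have wS : #|` a |` S| = #|` S|.+1 by rewrite cardfsU1 aS.
  have SaB : a |` S `<=` a |` B by apply: fsetUS.
  split; rewrite ?inE ?eqxx //; apply/and3P; split.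
  - by apply/fset0Pn; exists a; rewrite fset1U1.
  - by apply: contraNN B0; exact/fsubsetP.
  by rewrite /weight /label wS -(deck_standard dD); case: d dD.
have wS : #|` label c `\ a|.+1 = weight c.
  by rewrite /weight (cardfsD1 a (label c)) ac.
exists (label c `\ a), (interval1 (weight c), picture c); split.
- by rewrite /= fpowersetE fsubDset.
- by rewrite /= wS; case/and3P: cF.
by rewrite fsetD1K //; case: (c).
Qed.

Lemma uniq_cards_at a B : a \notin B -> uniq (cards_at a B).
Proof.
move=> aB; apply: allpairs_uniq_dep => [|S _|]; rewrite ?fset_uniq //.
move=> _ _ /allpairsPdep[S [c [/= SB cD ->]]] /allpairsPdep[T [d [/= TB dD ->]]].
rewrite !fpowersetE in SB TB => -[ST pcd].
have notin_sub E : E `<=` B -> a \notin E.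
  by move=> EB; apply: contraNN aB; exact/fsubsetP.
have eST : S = T.
  by rewrite -(fsetU1K (notin_sub _ SB)) ST fsetU1K ?notin_sub.
move: cD pcd; rewrite eST => cD pcd.
move: (deck_standard cD) (deck_standard dD) pcd.
by case: c d {cD dD} => [? ?] [? ?]; rewrite /label /picture /= => -> -> ->.
Qed.

(** A hand on A is determined by the card c that contains the label a and by the
    hand on the remaining labels; when cards are monochromatic, the labels of c
    all have the colour of a. *)
Lemma mono_hands_rec k A a : 0 \notin A -> a \in A ->
  perm_eq (mono_hands k A)
    [seq c |` H | c <- cards_at a (fiber k A (k a) `\ a),
                  H <- mono_hands k (A `\` label c)].
Proof.
move=> A0 aA; set B := fiber k A (k a) `\ a.
have aB : a \notin B by rewrite !inE eqxx.
have aBE : a |` B = fiber k A (k a).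
  by rewrite fsetD1K // !inE aA eqxx.
have fA : fiber k A (k a) `<=` A by apply: fset_sub.
have aB0 : 0 \notin a |` B.
  by rewrite aBE; apply: contraNN A0; exact/fsubsetP.
have notinH (c : pcard P) H : hand_on (A `\` label c) H -> a \in label c ->
    forall d, d \in H -> a \notin label d.
  move=> /hand_onP[Hc _ _] ac d /Hc[_ /fsubsetP sub].
  by apply/negP => /sub; rewrite !inE ac.
apply: uniq_perm; first exact: fset_uniq.
  apply: allpairs_uniq_dep; first exact: uniq_cards_at.
    by move=> c _; exact: fset_uniq.
  move=> _ _ /allpairsPdep[c [H [/= cB HA ->]]] /allpairsPdep[d [I [/= dB IA ->]]].
  move: cB dB HA IA; rewrite !cards_atP // !in_mono_hands.
  move=> /and3P[_ ac _] /and3P[_ ad _] /andP[HA _] /andP[IA _] /= eHI.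
  have cNH : c \notin H by apply/negP => /(notinH _ _ HA ac); rewrite ac.
  have dNI : d \notin I by apply/negP => /(notinH _ _ IA ad); rewrite ad.
  have ecd : c = d.
    have : c \in d |` I by rewrite -eHI fset1U1.
    by rewrite !inE => /orP[/eqP//|/(notinH _ _ IA ad)]; rewrite ac.
  move: eHI; rewrite -ecd => eHI; rewrite -ecd in dNI.
  by rewrite -(fsetU1K cNH) eHI fsetU1K.
move=> H; apply/idP/allpairsPdep => [|[c [I [/= cB IA ->]]]].
  rewrite in_mono_hands => /andP[/hand_onP[Hc Hd HA] /allP Hk].
  have [c cH ac] := HA a aA.
  have cB : label c `<=` fiber k A (k a).
    apply/fsubsetP => b bc; rewrite !inE /=.
    have /Hk/monochromeP/(_ b a bc ac) -> := cH.
    by rewrite eqxx andbT; have [_ /fsubsetP] := Hc c cH; apply.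
  exists c, (H `\ c); split; last by rewrite fsetD1K.
    by rewrite /= cards_atP // ac aBE cB; have [->] := Hc c cH.
  rewrite /= in_mono_hands; apply/andP; split; last first.
    by apply/allP => d; rewrite !inE => /andP[_ /Hk].
  apply/hand_onP; split.
  - move=> d; rewrite !inE => /andP[dc dH]; have [dF /fsubsetP dA] := Hc d dH.
    split=> //; apply/fsubsetP => b bd; rewrite !inE dA // andbT.
    by apply: contraNN dc => bc; rewrite (Hd c d b).
  - by move=> d e b; rewrite !inE => /andP[_ dH] /andP[_ eH]; exact: Hd.
  move=> b; rewrite !inE => /andP[bc /HA[d dH bd]]; exists d => //.
  by rewrite !inE dH andbT; apply: contraNneq bc => <-.
move: cB IA; rewrite cards_atP // !in_mono_hands.
move=> /and3P[cF ac cB] /andP[/hand_onP[Hc Hd HA] /allP Hk].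
rewrite aBE in cB; have cA := fsubset_trans cB fA.
have disj d b : d \in I -> b \in label d -> b \notin label c.
  by move=> /Hc[_ /fsubsetP sub] /sub; rewrite !inE => /andP[].
apply/andP; split; last first.
  apply/allP => d; rewrite !inE => /orP[/eqP ->|/Hk//].
  apply/monochromeP => i j /(fsubsetP cB) + /(fsubsetP cB).
  by rewrite !inE => /andP[_ /eqP->] /andP[_ /eqP->].
apply/hand_onP; split.
- move=> d; rewrite !inE => /orP[/eqP ->//|/Hc[dF dA]]; split=> //.
  exact/(fsubset_trans dA)/fsubsetDl.
- move=> d e b; rewrite !inE => /orP[/eqP->|dI] /orP[/eqP->|eI] // bd be.
  + by have := disj e b eI be; rewrite bd.
  + by have := disj d b dI bd; rewrite be.
  exact: Hd bd be.
move=> b bA; have [bc|bc] := boolP (b \in label c).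
  by exists c; rewrite ?fset1U1.
by have [|d dI bd] := HA b; [rewrite !inE bc|exists d; rewrite // !inE dI orbT].
Qed.

End MonochromaticHands.

(** * The type of monochromatic hands is a product over the colours *)

Section OneColour.
Local Open Scope fset_scope.
Variables (K : fieldType) (P : choiceType) (F : exp_family P).
Implicit Types (A B E : {fset nat}) (H : {fset pcard P}).

Definition mono_enum (C : eqType) (k : nat -> C) A : ypoly K :=
  \sum_(H <- mono_hands F k A) hand_type K H.

(** This is h_n(1), written w_n in the overview. *)
Definition hand_enum n : ypoly K := \sum_(H <- hands F n) hand_type K H.

Lemma hand_enum0 : hand_enum 0 = 1.
Proof. by rewrite /hand_enum hands0 big_seq_fset1 /hand_type big_seq_fset0. Qed.

Lemma mono_enum_interval (C : eqType) (k : nat -> C) n :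
  (forall i j, k i = k j) -> mono_enum k (interval1 n) = hand_enum n.
Proof. by move=> kC; rewrite /mono_enum mono_hands_interval. Qed.

Lemma mono_enum0 (C : eqType) (k : nat -> C) : mono_enum k fset0 = 1.
Proof.
suff hE : mono_hands F k fset0 = hands F 0.
  by rewrite /mono_enum hE -/(hand_enum 0) hand_enum0.
apply/fsetP => H; rewrite in_mono_hands in_hands is_handE interval1_0 andb_idr //.
move=> /hand_onP[Hc _ _]; apply/allP => c /Hc[/and3P[c0 _ _]].
by rewrite fsubset0 (negbTE c0).
Qed.

(** Removing the card through a; the factor in front counts the pictures that the
    deck offers for the label set a |` E. *)
Lemma mono_enum_rec (C : eqType) (k : nat -> C) A a : 0%N \notin A -> a \in A ->
  mono_enum k A = \sum_(E <- fpowerset (fiber k A (k a) `\ a))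
    (yvar K #|` E|.+1 *+ #|` deck F #|` E|.+1|) * mono_enum k (A `\` (a |` E)).
Proof.
move=> A0 aA; rewrite /mono_enum (perm_big _ (mono_hands_rec F k A0 aA)) /=.
rewrite big_allpairs_dep /= /cards_at big_allpairs_dep /=.
apply: eq_big_seq => E; rewrite fpowersetE => EB.
have aE : a \notin E.
  by apply/negP => /(fsubsetP EB); rewrite !inE eqxx.
rewrite mulrnAl big_seq.
rewrite (eq_bigr (fun=> yvar K #|` E|.+1 * mono_enum k (A `\` (a |` E)))).
  by rewrite -big_seq big_const_seq count_predT iter_addr_0.
move=> c cD; rewrite /mono_enum big_distrr /=.
apply: eq_big_seq => H; rewrite in_mono_hands => /andP[/hand_onP[Hc _ _] _].
rewrite /hand_type big_fsetU1 /=.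
  by rewrite /weight /label /= cardfsU1 aE.
by apply/negP => /Hc[_ /fsubsetP/(_ a)]; rewrite !inE eqxx => /(_ isT).
Qed.

Lemma sum_fpowersetU1 (f : nat -> ypoly K) a B : a \notin B ->
  \sum_(E <- fpowerset (a |` B)) f #|` E| =
    \sum_(E <- fpowerset B) (f #|` E| + f #|` E|.+1).
Proof.
move=> aB; have sub E : E `<=` B -> a \notin E.
  by move=> EB; apply: contraNN aB; exact/fsubsetP.
have pE : perm_eq (fpowerset (a |` B))
    (fpowerset B ++ [seq a |` E | E <- fpowerset B]).
  apply: uniq_perm; first exact: fset_uniq.
    rewrite cat_uniq fset_uniq map_inj_in_uniq ?fset_uniq ?andbT /=.
      apply/hasPn => _ /mapP[E EB ->]; rewrite fpowersetE; apply/negP.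
      by move/fsubsetP/(_ a); rewrite fset1U1 => /(_ isT); apply/negP.
    move=> E G; rewrite !fpowersetE => /sub aE /sub aG eEG.
    by rewrite -(fsetU1K aE) eEG fsetU1K.
  move=> E; rewrite mem_cat !fpowersetE; apply/idP/orP => [EB|[EB|]].
  - have [aE|aE] := boolP (a \in E).
      right; apply/mapP; exists (E `\ a); last by rewrite fsetD1K.
      by rewrite fpowersetE fsubDset.
    left; apply/fsubsetP => b bE; have := fsubsetP EB b bE.
    by rewrite !inE => /orP[/eqP ba|//]; rewrite -ba bE in aE.
  - exact/(fsubset_trans EB)/fsubsetUr.
  by move=> /mapP[G GB ->]; apply: fsetUS; rewrite -fpowersetE.
rewrite (perm_big _ pE) /= big_cat big_map big_split /=.
congr (_ + _)%R.
apply: eq_big_seq => E; rewrite fpowersetE => /sub aE.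
by rewrite cardfsU1 aE.
Qed.

Lemma eq_sum_fpowerset (f : nat -> ypoly K) A B : #|` A| = #|` B| ->
  \sum_(E <- fpowerset A) f #|` E| = \sum_(E <- fpowerset B) f #|` E|.
Proof.
have [n] := ubnP #|` A|; elim: n => // n IHn in f A B *.
have [->|[a aA]] := fset_0Vmem A.
  by rewrite cardfs0 => _ /esym/cardfs0_eq->.
have [->|[b bB]] := fset_0Vmem B.
  by rewrite cardfs0 => _ /cardfs0_eq->.
rewrite -(fsetD1K aA) -(fsetD1K bB) !sum_fpowersetU1 ?inE ?eqxx //.
rewrite !cardfsU1 !inE !eqxx /= !ltnS => ltn [eAB].
by rewrite !big_split /= (IHn f _ _ ltn eAB) (IHn (f \o succn) _ _ ltn eAB).
Qed.

(** Relabelling invariance without relabelling: on A and on the interval of the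
    same size, removing the card through some label gives the same recursion,
    in which only numbers of labels occur. *)
Lemma mono_enum_card A : 0%N \notin A ->
  mono_enum (fun=> tt) A = hand_enum #|` A|.
Proof.
have [n] := ubnP #|` A|; elim: n => // n IHn in A * => ltAn A0.
have [->|[a aA]] := fset_0Vmem A.
  by rewrite cardfs0 mono_enum0 hand_enum0.
pose g e : ypoly K :=
  (yvar K e.+1 *+ #|` deck F e.+1|) * hand_enum (#|` A| - e.+1)%N.
have step A' a' : #|` A'| = #|` A| -> 0%N \notin A' -> a' \in A' ->
    mono_enum (fun=> tt) A' = \sum_(E <- fpowerset (A' `\ a')) g #|` E|.
  move=> cA A'0 a'A; rewrite (mono_enum_rec _ A'0 a'A).
  have -> : fiber (fun=> tt) A' tt = A'.
    by apply/fsetP => b; rewrite !inE eqxx andbT.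
  apply: eq_big_seq => E; rewrite fpowersetE => EA.
  have a'E : a' \notin E.
    by apply/negP => /(fsubsetP EA); rewrite !inE eqxx.
  have cE : #|` A' `\` (a' |` E)| = (#|` A| - #|` E|.+1)%N.
    rewrite cardfsDS ?cA ?cardfsU1 ?a'E // fsubUset fsub1set a'A /=.
    exact/(fsubset_trans EA)/fsubD1set.
  rewrite /g IHn ?cE //.
    rewrite -ltnS (leq_trans _ ltAn) // ltnS ltn_subrL -cA cardfs_gt0 /=.
    by apply/fset0Pn; exists a'.
  by rewrite inE (negbTE A'0) andbF.
have A1 : 1%N \in interval1 #|` A|.
  by rewrite in_interval1 /= cardfs_gt0; apply/fset0Pn; exists a.
rewrite -(mono_enum_interval (k := fun=> tt)) // (step A a) //.
rewrite (step _ 1%N) ?card_interval1 ?in_interval1 //; last first.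
  by rewrite in_interval1 in A1.
apply: eq_sum_fpowerset; apply: succn_inj.
transitivity #|` A|; first by rewrite (cardfsD1 a A) aA.
by rewrite -[LHS]card_interval1 (cardfsD1 1%N (interval1 _)) A1.
Qed.


Lemma fiberD (C : eqType) (k : nat -> C) A B x :
  fiber k (A `\` B) x = fiber k A x `\` B.
Proof. by apply/fsetP => b; rewrite !inE /= -!andbA. Qed.

(** The card through a affects only the colour of a.  The recursion
    for A is therefore the recursion for the fiber of that colour, times the
    factors of the other colours, and the fiber can be treated as uncoloured. *)
Lemma mono_enum_prod (C : finType) (k : nat -> C) A : 0%N \notin A ->
  mono_enum k A = \prod_x hand_enum #|` fiber k A x|.
Proof.
have [n] := ubnP #|` A|; elim: n => // n IHn in A * => ltAn A0.
have [->|[a aA]] := fset_0Vmem A.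
  rewrite mono_enum0 big1 // => x _.
  suff -> : fiber k fset0 x = fset0 by rewrite cardfs0 hand_enum0.
  by apply/fsetP => b; rewrite !inE.
set B := fiber k A (k a).
have BA : B `<=` A by apply: fset_sub.
have B0 : 0%N \notin B by apply: contraNN A0; exact/fsubsetP.
have aB : a \in B by rewrite !inE aA eqxx.
rewrite (bigD1 (k a)) //= -/B -mono_enum_card //.
rewrite (mono_enum_rec _ A0 aA) (mono_enum_rec _ B0 aB) big_distrl /=.
have -> : fiber (fun=> tt) B tt = B.
  by apply/fsetP => b; rewrite !inE eqxx !andbT.
apply: eq_big_seq => E; rewrite fpowersetE -/B => EB.
rewrite -mulrA; congr (_ * _)%R.
have aEB : a |` E `<=` B.
  by rewrite fsubUset fsub1set aB (fsubset_trans EB) ?fsubD1set.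
have lt_AE : (#|` A `\` (a |` E)| < n)%N.
  apply: leq_trans (_ : #|` A| <= n)%N; last by [].
  rewrite cardfsDS ?(fsubset_trans aEB BA) // ltn_subrL !cardfs_gt0.
  by apply/andP; split; apply/fset0Pn; exists a; rewrite // !inE eqxx.
have notinD X : 0%N \notin X -> 0%N \notin X `\` (a |` E).
  by move=> X0; rewrite inE (negbTE X0) andbF.
rewrite (IHn _ lt_AE (notinD _ A0)) (mono_enum_card (notinD _ B0)).
rewrite [LHS](bigD1 (k a) isT) /= fiberD.
congr (_ * _)%R; apply: eq_bigr => x xka; rewrite fiberD.
suff -> : fiber k A x `\` (a |` E) = fiber k A x by [].
apply/fsetDidPl/fdisjointP => b; rewrite !inE /= => /andP[_ /eqP bx].
apply: contraNN xka => b_aE; rewrite -bx.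
have /(fsubsetP aEB) : b \in a |` E by rewrite !inE.
by rewrite !inE /= => /andP[].
Qed.

End OneColour.

(** * Sums over colourings and the first failure of the parking condition *)

(** Labels form an arbitrary finite type, so that colourings can be restricted to
    subsets of labels; colours are compared through their values v. *)
Section ColouringSums.
Variables (R : comNzRingType) (w : nat -> R) (w0 : w 0 = 1).
Variables (C : finType) (v : C -> nat) (z : nat -> nat).
Hypothesis z_homo : {homo z : i j / (i <= j)%N}.

Definition colouring_weight (T : finType) (k : {ffun T -> C}) : R :=
  \prod_x w #|[set t | k t == x]|.

Definition below (T : finType) (k : {ffun T -> C}) (a : nat) : {set T} :=
  [set t | (v (k t) <= a)%N].

(** The j-th smallest value (from 0) is at most z_j exactly when more than j labels
    have a value at most z_j; this form involves no sorting and restricts well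
    to subsets of labels. *)
Definition parking (T : finType) (k : {ffun T -> C}) : bool :=
  [forall j : 'I_#|T|, (j < #|below k (z j)|)%N].

Definition above (T : finType) (a : nat) (k : {ffun T -> C}) : bool :=
  [forall t, (a < v (k t))%N].

Lemma parkingP (T : finType) (k : {ffun T -> C}) :
  reflect (forall j, (j < #|T|)%N -> (j < #|below k (z j)|)%N) (parking k).
Proof.
apply: (iffP forallP) => [kp j jT|kp j]; last exact: kp.
exact: (kp (Ordinal jT)).
Qed.

Lemma sum_colouring_bij (T T' : finType) (e : T' -> T)
    (Q : pred {ffun T -> C}) (Q' : pred {ffun T' -> C}) :
  bijective e -> (forall k : {ffun T -> C}, Q' [ffun t => k (e t)] = Q k) ->
  \sum_(k | Q k) colouring_weight k = \sum_(k | Q' k) colouring_weight k.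
Proof.
move=> [e' eK e'K] QQ'.
rewrite [RHS](reindex (fun k : {ffun T -> C} => [ffun t => k (e t)])); last first.
  exists (fun k : {ffun T' -> C} => [ffun t => k (e' t)]) => k _;
    by apply/ffunP => t; rewrite !ffunE ?eK ?e'K.
apply: eq_big => [k|k _]; first by rewrite QQ'.
apply: eq_bigr => x _; congr w.
rewrite -(card_imset _ (can_inj eK)); apply: eq_card => t; rewrite inE.
apply/idP/imsetP => [kt|[s + ->]]; last by rewrite inE ffunE.
by exists (e' t); rewrite ?inE ?ffunE e'K.
Qed.

Lemma parking_bij (T T' : finType) (e : T' -> T) (k : {ffun T -> C}) :
  bijective e -> parking [ffun t => k (e t)] = parking k.
Proof.
move=> be; have cT := bij_eq_card be; case: (be) => e' eK e'K.
have cb a : #|below [ffun t => k (e t)] a| = #|below k a|.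
  rewrite -(card_imset _ (can_inj eK)); apply: eq_card => t; rewrite inE.
  apply/imsetP/idP => [[s + ->]|kt]; first by rewrite inE ffunE.
  by exists (e' t); rewrite ?inE ?ffunE e'K.
by apply/parkingP/parkingP => kp j; [rewrite -cT -cb|rewrite cT cb]; apply: kp.
Qed.

Lemma above_bij (T T' : finType) (e : T' -> T) (k : {ffun T -> C}) a :
  bijective e -> above a [ffun t => k (e t)] = above a k.
Proof.
move=> [e' eK e'K]; apply/forallP/forallP => ka t.
  by have := ka (e' t); rewrite ffunE e'K.
by rewrite ffunE.
Qed.

Definition parking_sum m : R :=
  \sum_(k : {ffun 'I_m -> C} | parking k) colouring_weight k.

Definition above_sum a m : R :=
  \sum_(k : {ffun 'I_m -> C} | above a k) colouring_weight k.

Definition restrict (T : finType) (A : {set T}) (k : {ffun T -> C}) :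
  {ffun {t | t \in A} -> C} := [ffun t => k (val t)].

Lemma card_restrict (T : finType) (A : {set T}) (Q : pred T) :
  #|[set t : {t | t \in A} | Q (val t)]| = #|[set t in A | Q t]|.
Proof.
rewrite -(card_imset _ val_inj); apply: eq_card => t; rewrite !inE.
apply/imsetP/andP => [[s + ->]|[tA Qt]]; first by rewrite inE (valP s).
by exists (exist _ t tA); rewrite ?inE.
Qed.

Lemma restrict_bij (T : finType) (A : {set T}) :
  bijective (fun k : {ffun T -> C} => (restrict A k, restrict (~: A) k)).
Proof.
apply: inj_card_bij => [k l [/ffunP kA /ffunP kAC]|].
  apply/ffunP => t; have [tA|tA] := boolP (t \in A).
    by have := kA (exist _ t tA); rewrite !ffunE.
  have tAC : t \in ~: A by rewrite inE.
  by have := kAC (exist _ t tAC); rewrite !ffunE.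
by rewrite card_prod !card_ffun !card_sig -expnD cardsC.
Qed.

Lemma bij_ord (T : finType) m : #|T| = m -> exists e : 'I_m -> T, bijective e.
Proof. by move=> <-; exists enum_val; exact: enum_val_bij. Qed.

(** A is the set of labels on which the colouring is parking, in a splitting at the
    threshold z_i with i = #|A|. *)
Definition cut (T : finType) (k : {ffun T -> C}) (A : {set T}) : bool :=
  parking (restrict A k) && above (z #|A|) (restrict (~: A) k).

(** Colours at most z_i occur only in A and the others only outside A, so for each
    colour one of the two factors is w_0 = 1. *)
Lemma cut_weight (T : finType) (k : {ffun T -> C}) (A : {set T}) :
  (forall t, (t \in A) = (v (k t) <= z #|A|)%N) ->
  colouring_weight k =
    colouring_weight (restrict A k) * colouring_weight (restrict (~: A) k).
Proof.
move=> Ak; rewrite /colouring_weight -big_split /=; apply: eq_bigr => x _.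
have cr B : #|[set t | restrict B k t == x]| = #|[set t in B | k t == x]|.
  rewrite -(card_restrict B (fun t => k t == x)).
  by apply: eq_card => t; rewrite !inE ffunE.
rewrite !cr; have [xz|xz] := leqP (v x) (z #|A|).
  rewrite [X in w _ = _ * w X](_ : _ = 0)%N ?w0 ?mulr1.
    congr w; apply: eq_card => t; rewrite !inE.
    by case: eqP => [kt|]; rewrite ?andbF // Ak kt xz.
  apply: eq_card0 => t; rewrite !inE Ak.
  by case: eqP => [->|]; rewrite ?andbF // xz.
rewrite [X in _ = w X * _](_ : _ = 0)%N ?w0 ?mul1r.
  congr w; apply: eq_card => t; rewrite !inE.
  by case: eqP => [kt|]; rewrite ?andbF // Ak kt leqNgt xz.
apply: eq_card0 => t; rewrite !inE Ak.
by case: eqP => [->|]; rewrite ?andbF // leqNgt xz.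
Qed.

Lemma below_restrict (T : finType) (k : {ffun T -> C}) (A : {set T}) a :
  #|below (restrict A k) a| = #|A :&: below k a|.
Proof.
transitivity #|[set t in A | v (k t) <= a]%N|; last first.
  by apply: eq_card => t; rewrite !inE.
rewrite -(card_restrict A (fun t => v (k t) <= a)%N).
by apply: eq_card => t; rewrite !inE ffunE.
Qed.

(** Being a cut is a condition on the number i = #|A| alone: A consists of the
    labels of value at most z_i, and i is the least index at which the parking
    condition fails.  The statement speaks of the whole colouring, because below
    z_j <= z_i the restriction to A and the colouring have the same labels. *)
Lemma cutP (T : finType) (k : {ffun T -> C}) (A : {set T}) :
  reflect (A = below k (z #|A|) /\
           forall j, (j < #|A|)%N -> (j < #|below k (z j)|)%N) (cut k A).
Proof.
apply: (iffP andP) => [[/parkingP kp /forallP ka]|[AE kp]].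
  rewrite card_sig in kp.
  have {}kp j : (j < #|A|)%N -> (j < #|A :&: below k (z j)|)%N.
    by rewrite -below_restrict; apply: kp.
  split; last first.
    move=> j /kp jA; apply: leq_trans jA _; apply: subset_leq_card.
    exact: subsetIr.
  apply/setP => t; rewrite inE; have [tA|tA] := boolP (t \in A); last first.
    have tAC : t \in ~: A by rewrite inE.
    have := ka (exist _ t tAC); rewrite ffunE /= => zt.
    by rewrite leqNgt zt.
  have A0 : (0 < #|A|)%N by rewrite card_gt0; apply/set0Pn; exists t.
  have := kp #|A|.-1; rewrite ltn_predL prednK // => /(_ A0) cA.
  have /setIidPl/setP/(_ t) : A \subset below k (z #|A|.-1).
    apply/setIidPl/eqP; rewrite eqEcard subsetIl /=; exact: cA.
  by rewrite !inE tA => kt; rewrite (leq_trans kt) // z_homo // leq_pred.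
split; last first.
  apply/forallP => -[t /= tA]; rewrite ffunE /=.
  by move: tA; rewrite inE {1}AE inE -ltnNge.
apply/parkingP; rewrite card_sig => j jA; rewrite below_restrict.
rewrite (setIidPr _) ?kp // AE; apply/subsetP => t; rewrite !inE => kt.
by apply: leq_trans kt _; apply: z_homo; exact: ltnW.
Qed.

(** The cut is given by the least i such that at most i labels have value at most
    z_i.  The index i = #|T| always qualifies, and the parking colourings are
    those for which no smaller one does. *)
Lemma exists_cut (T : finType) (k : {ffun T -> C}) :
  exists A, forall B, cut k B = (A == B).
Proof.
have exi : exists i, (#|below k (z i)| <= i)%N by exists #|T|; exact: max_card.
case: (ex_minnP exi) => i ki i_min; exists (below k (z i)).
have lt_i j : (j < i)%N -> (j < #|below k (z j)|)%N.
  by move=> ji; rewrite ltnNge; apply/negP => /i_min; rewrite leqNgt ji.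
have ci : #|below k (z i)| = i.
  (* At least i labels by minimality at i - 1 and monotonicity of z. *)
  apply/eqP; rewrite eqn_leq ki /=; case: i lt_i {ki i_min} => // i lt_i.
  apply: leq_trans (lt_i i _) _ => //; apply: subset_leq_card.
  by apply/subsetP => t; rewrite !inE => /leq_trans->//; exact: z_homo.
move=> B; apply/cutP/eqP => [[BE kp]|<-]; last by rewrite ci.
suff -> : i = #|B| by [].
apply/eqP; rewrite eqn_leq i_min -?BE // andTb leqNgt; apply/negP => /kp.
by rewrite ci ltnn.
Qed.

(** Group the colourings by their cut; the binomial coefficient counts the sets of
    labels of size i. *)
Lemma sum_colouring_decomp n :
  \sum_(k : {ffun 'I_n -> C}) colouring_weight k =
    \sum_(i < n.+1) 'C(n, i)%:R * (parking_sum i * above_sum (z i) (n - i)).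
Proof.
transitivity (\sum_(A : {set 'I_n})
    parking_sum #|A| * above_sum (z #|A|) (n - #|A|)).
  transitivity (\sum_(A : {set 'I_n}) \sum_(k | cut k A) colouring_weight k).
    rewrite (exchange_big_dep predT) //=; apply: eq_bigr => k _.
    have [A Ak] := exists_cut k.
    by rewrite (eq_bigl (pred1 A)) ?big_pred1_eq // => B; rewrite Ak eq_sym.
  apply: eq_bigr => A _.
  transitivity (\sum_(k1 : {ffun {t | t \in A} -> C} | parking k1)
      \sum_(k2 : {ffun {t | t \in ~: A} -> C} | above (z #|A|) k2)
        colouring_weight k1 * colouring_weight k2).
    rewrite pair_big /= [RHS](reindex _ (onW_bij _ (restrict_bij A))) /=.
    apply: eq_bigr => k /cutP[AE _]; apply: cut_weight => t.
    by rewrite {1}AE inE.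
  have cA : #|{: {t | t \in A}}| = #|A| by rewrite card_sig.
  have cAC : #|{: {t | t \in ~: A}}| = (n - #|A|)%N.
    by rewrite card_sig -[X in (X - _)%N]card_ord -(cardsC A) addKn.
  have [e be] := bij_ord cA; have [e' be'] := bij_ord cAC.
  rewrite -big_distrlr /=; congr (_ * _).
    by apply: (sum_colouring_bij be) => k; exact: (parking_bij k be).
  apply: (sum_colouring_bij be') => k. exact: (above_bij k _ be').
pose G i := parking_sum i * above_sum (z i) (n - i).
rewrite (partition_big (fun A : {set 'I_n} => inord #|A| : 'I_n.+1) xpredT) //=.
apply: eq_bigr => i _.
have cE (A : {set 'I_n}) : (inord #|A| == i) = (#|A| == i).
  by rewrite -val_eqE /= inordK // ltnS -[X in (_ <= X)%N]card_ord max_card.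
rewrite (eq_bigr (fun=> G i)); last by move=> A; rewrite cE => /eqP->.
rewrite sumr_const mulr_natl (eq_card (B := [set A : {set 'I_n} | #|A| == i])).
  by rewrite card_draws card_ord.
by move=> A; rewrite !inE -cE.
Qed.

End ColouringSums.

(** * From functions on the cards to colourings of the labels *)

(** The labels 1, ..., n are indexed by 'I_n with a shift by one.  The colour x0 is
    a default value, never reached on a hand of weight n. *)
Section Colourings.
Local Open Scope fset_scope.
Variables (K : fieldType) (P : choiceType) (F : exp_family P).
Variables (C : finType) (x0 : C) (n : nat).
Implicit Types (H : {fset pcard P}) (k : {ffun 'I_n -> C}).

Definition label_colouring H (g : {ffun H -> C}) : {ffun 'I_n -> C} :=
  [ffun i : 'I_n => oapp g x0 [pick c : H | i.+1 \in label (val c)]].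

Definition extend k (a : nat) : C := oapp k x0 (insub a.-1).

Lemma extendE k (i : 'I_n) : extend k i.+1 = k i.
Proof. by rewrite /extend /= valK. Qed.

Lemma label_colouringE H (g : {ffun H -> C}) (c : H) (i : 'I_n) :
  hand_on F (interval1 n) H -> i.+1 \in label (val c) ->
  label_colouring g i = g c.
Proof.
move=> /hand_onP[_ Hd _] ic; rewrite ffunE.
case: pickP => [d id|/(_ c)]; last by rewrite ic.
by congr (g _); apply/val_inj/(Hd _ _ i.+1 (valP d) (valP c) id ic).
Qed.

Lemma hand_label H (c : H) : hand_on F (interval1 n) H ->
  exists i : 'I_n, i.+1 \in label (val c).
Proof.
move=> /hand_onP[Hc _ _]; have [/and3P[/fset0Pn[a ac] _ _] cn] := Hc _ (valP c).
have := fsubsetP cn a ac; rewrite in_interval1 => /andP[a0 an].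
have an' : (a.-1 < n)%N by rewrite prednK.
by exists (Ordinal an'); rewrite /= prednK.
Qed.

Lemma label_colouring_inj H : hand_on F (interval1 n) H ->
  injective (@label_colouring H).
Proof.
move=> hH g h /ffunP egh; apply/ffunP => c; have [i ic] := hand_label c hH.
by have := egh i; rewrite !(label_colouringE _ hH ic).
Qed.

(** A colouring under which every card is monochromatic comes from a function on
    the cards: the colour of a card is that of any of its labels. *)
Lemma imset_label_colouring H : hand_on F (interval1 n) H ->
  [set label_colouring g | g in {ffun H -> C}] =
    [set k | all (monochrome (extend k)) H].
Proof.
move=> hH; apply/setP => k; rewrite inE; apply/imsetP/allP => [[g _ ->]|Hk].
  move=> c cH; apply/monochromeP.
  have val_col a : a \in label c -> extend (label_colouring g) a = g [` cH].
    move=> ac; have /hand_onP[Hc _ _] := hH; have [_ /fsubsetP cn] := Hc c cH.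
    have := cn a ac; rewrite in_interval1 => /andP[a0 an].
    have an' : (a.-1 < n)%N by rewrite prednK.
    rewrite -(prednK a0) (extendE _ (Ordinal an')).
    by apply: label_colouringE => //=; rewrite prednK.
  by move=> i j ic jc; rewrite !val_col.
pose g := [ffun c : H =>
  oapp k x0 [pick i : 'I_n | i.+1 \in label (val c)]].
exists g => //; apply/ffunP => i; have /hand_onP[_ _ HA] := hH.
have [|c cH ic] := HA i.+1; first by rewrite in_interval1 ltn_ord.
rewrite (label_colouringE (c := [` cH]) _ hH ic) ffunE.
case: pickP => [j jc|/(_ i)]; last by rewrite ic.
by have /Hk/monochromeP/(_ _ _ ic jc) := cH; rewrite !extendE.
Qed.

Lemma card_label_colouring (Q : pred {ffun 'I_n -> C}) H :
  hand_on F (interval1 n) H ->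
  #|[set g : {ffun H -> C} | Q (label_colouring g)]| =
    #|[set k | Q k && all (monochrome (extend k)) H]|.
Proof.
move=> hH; rewrite -(card_imset _ (label_colouring_inj hH)).
apply: eq_card => k; rewrite inE.
have /setP/(_ k) := imset_label_colouring hH; rewrite !inE => <-.
apply/imsetP/andP => [[g]|[Qk /imsetP[g _ kE]]].
  by rewrite inE => Qg ->; split=> //; apply/imsetP; exists g.
by exists g => //; rewrite inE -kE.
Qed.

Lemma card_fiber k x :
  #|` fiber (extend k) (interval1 n) x| = #|[set i | k i == x]|.
Proof.
have -> : fiber (extend k) (interval1 n) x =
    [fset (val i).+1 | i in [set i | k i == x]].
  apply/fsetP => a; apply/idP/imfsetP => [|[i /= + ->]]; rewrite !inE.
    rewrite /= mem_iota add1n ltnS => /andP[/andP[a0 an] ka].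
    have an' : (a.-1 < n)%N by rewrite prednK.
    exists (Ordinal an'); rewrite /= ?prednK // inE.
    by rewrite -(extendE _ (Ordinal an')) /= prednK.
  by rewrite mem_iota add1n !ltnS ltn_ord /= extendE.
rewrite card_imfset /=; last by move=> i j [] /val_inj.
by rewrite -cardE.
Qed.

(** Exchanging the sums over hands and over colourings leaves, for each colouring,
    the total type of its monochromatic hands, which [mono_enum_prod] gives. *)
Lemma sum_hands_colourings (Q : pred {ffun 'I_n -> C}) :
  \sum_(H <- hands F n) hand_type K H *
      #|[set g : {ffun H -> C} | Q (label_colouring g)]|%:R =
    \sum_(k | Q k) colouring_weight (hand_enum K F) k.
Proof.
transitivity (\sum_(H <- hands F n) \sum_(k | Q k)
    if all (monochrome (extend k)) H then hand_type K H else 0).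
  apply: eq_big_seq => H; rewrite in_hands is_handE => hH.
  rewrite card_label_colouring // -big_mkcondr /= -sum1dep_card natr_sum.
  by rewrite big_distrr /=; apply: eq_bigr => k _; rewrite mulr1.
rewrite exchange_big; apply: eq_bigr => k _.
rewrite -big_mkcond /= big_fset_condE.
have -> : [fset H in hands F n | all (monochrome (extend k)) H] =
    mono_hands F (extend k) (interval1 n).
  apply/fsetP => H; rewrite in_mono_hands [LHS]in_fset.
  by rewrite [LHS]inE /= in_hands is_handE.
rewrite -/(mono_enum K F (extend k) (interval1 n)) mono_enum_prod.
  by apply: eq_bigr => x _; rewrite card_fiber.
by rewrite in_interval1.
Qed.

(** The power #|B| ^ #|H| counts the functions from the cards of H to B.
    Allowing any set B of colours, instead of an initial interval,
    identifies the enumerator of the labels above a threshold. *)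
Lemma type_enum_colourings (B : {set C}) :
  (type_enum K F n).[#|B|%:R] =
    \sum_(k : {ffun 'I_n -> C} | [forall i, k i \in B])
      colouring_weight (hand_enum K F) k.
Proof.
rewrite -sum_hands_colourings /type_enum horner_sum; apply: eq_big_seq => H.
rewrite in_hands is_handE => hH.
rewrite hornerZ hornerXn -natrX; congr (_ * _%:R)%R.
rewrite cardfE -card_ffun_on; apply: eq_card => g; rewrite inE.
apply/ffun_onP/forallP => [gB i|gB c]; last first.
  by have [i ic] := hand_label c hH; rewrite -(label_colouringE g hH ic).
have /hand_onP[_ _ HA] := hH.
have [|c cH ic] := HA i.+1; first by rewrite in_interval1 ltn_ord.
by rewrite (label_colouringE (c := [` cH]) _ hH ic).
Qed.

End Colourings.

(** * The counting identity at natural numbers *)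

Section ParkingEnumerator.
Local Open Scope fset_scope.
Variables (K : fieldType) (P : choiceType) (F : exp_family P).
Variable z : nat -> nat.
Hypothesis z_homo : {homo z : i j / (i <= j)%N}.

Lemma is_parking_count n (s : n.-tuple nat) :
  is_parking [tuple z i | i < n] s =
    all (ltn 0) s && [forall j : 'I_n, (j < count (leq^~ (z j)) s)%N].
Proof.
rewrite /is_parking; congr (_ && _); apply: eq_forallb => j.
rewrite tnth_mktuple (tnth_nth 0%N) /=.
have ss : sorted leq (sort leq s) by apply: sort_sorted; exact: leq_total.
rewrite -(count_sort leq).
apply/idP/idP => [|jc]; last first.
  exact: (@Order.POrderTheory.nth_count_le _ nat (z j) 0%N).
rewrite leqNgt; apply: contraNT; rewrite -leqNgt => cj.
apply: (@Order.TotalTheory.DualTotalTheory.nth_count_gt _ nat (z j) 0%N) => //.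
by rewrite cj size_sort size_tuple /=.
Qed.

Definition parking_enum x n : ypoly K :=
  \sum_(H <- hands F n) hand_type K H * (PF x H [tuple z i | i < n])%:R.

Lemma parking_hand_seq x n (c0 : interval1 x) (H : {fset pcard P})
    (f : {ffun H -> interval1 x}) :
  hand_on F (interval1 n) H ->
  is_parking [tuple z i | i < n] (hand_seq n f) =
    parking val z (label_colouring c0 n f).
Proof.
move=> hH; have seqE : hand_seq n f =
    [tuple val (label_colouring c0 n f i) | i < n].
  apply/eq_from_tnth => i; rewrite !tnth_mktuple /card_value ffunE.
  case: pickP => //= no; have /hand_onP[_ _ HA] := hH.
  have [|c cH ic] := HA i.+1; first by rewrite in_interval1 ltn_ord.
  by have := no [` cH]; rewrite ic.
rewrite is_parking_count seqE.
have -> : all (ltn 0) [tuple val (label_colouring c0 n f i) | i < n].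
  apply/allP => _ /tnthP[i ->]; rewrite tnth_mktuple.
  by have := valP (label_colouring c0 n f i); rewrite in_interval1 => /andP[].
have cb a : count (leq^~ a) [tuple val (label_colouring c0 n f i) | i < n] =
    #|below val (label_colouring c0 n f) a|.
  by rewrite /= count_map cardsE cardE size_filter -enumT.
rewrite andTb; apply/forallP/parkingP => [kp j|kp j].
  by rewrite card_ord => jn; have := kp (Ordinal jn); rewrite cb.
by rewrite cb; apply: kp; rewrite card_ord.
Qed.

Lemma card_interval_above x a :
  #|[set c : interval1 x | (a < val c)%N]| = (x - a)%N.
Proof.
rewrite -sum1dep_card -(big_seq_fsetE _ _ (fun b => a < b)%N (fun=> 1%N)) /=.
rewrite (perm_big (index_iota 1 x.+1)) /=; last first.
  apply: uniq_perm; rewrite ?fset_uniq ?iota_uniq // => b.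
  by rewrite in_interval1 mem_index_iota ltnS.
have [xa|ax] := leqP x a.
  rewrite big_nat_cond big1 => [|b]; first by apply/esym/eqP; rewrite subn_eq0.
  by rewrite ltnS => /andP[/andP[_ /leq_trans/(_ xa)]]; rewrite leqNgt => /negbTE->.
rewrite (@big_cat_nat _ _ _ a.+1) //=; last by rewrite ltnS ltnW.
rewrite big_nat_cond big1 => [|b]; last first.
  by rewrite ltnS => /andP[/andP[_ +]]; rewrite leqNgt => /negbTE->.
rewrite add0n big_mkcond (eq_big_nat _ _ (F2 := fun=> 1%N)).
  by rewrite sum_nat_const_nat muln1 subSS.
by move=> b /andP[-> _].
Qed.

(** The sum over colourings decomposed at the cut, each of the three sums being
    read back as a sum over hands. *)
Lemma type_enum_parking x n : (0 < x)%N ->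
  (type_enum K F n).[x%:R] =
    \sum_(i < n.+1) 'C(n, i)%:R *
      ((type_enum K F (n - i)).[(x - z i)%N%:R] * parking_enum x i).
Proof.
move=> x0; have x_x : x \in interval1 x by rewrite in_interval1 x0 leqnn.
pose c0 : interval1 x := [` x_x].
have -> : (type_enum K F n).[x%:R] =
    \sum_(k : {ffun 'I_n -> interval1 x}) colouring_weight (hand_enum K F) k.
  have cT : #|[set: interval1 x]| = x by rewrite cardsT -cardfE card_interval1.
  rewrite -[in LHS]cT (type_enum_colourings _ _ c0); apply: eq_bigl => k.
  by apply/forallP => i; rewrite inE.
rewrite (sum_colouring_decomp (hand_enum0 K F) val z_homo).
apply: eq_bigr => i _; rewrite [parking_sum _ _ _ _ * _]mulrC.
congr (_ * (_ * _))%R.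
  rewrite -(card_interval_above x (z i)) (type_enum_colourings _ _ c0).
  by apply: eq_bigl => k; apply: eq_forallb => t; rewrite inE.
rewrite /parking_sum -(sum_hands_colourings _ _ c0); apply: eq_big_seq => H.
rewrite in_hands is_handE => hH; congr (_ * _%:R)%R.
by apply: eq_card => f; rewrite !inE (parking_hand_seq c0).
Qed.

(** The largest value of a parking function of length n is at most z_(n-1). *)
Lemma PF_widen x y n (H : {fset pcard P}) :
  (x <= y)%N -> (forall i, (z i <= x)%N) -> (0 < x)%N ->
  hand_on F (interval1 n) H ->
  PF y H [tuple z i | i < n] = PF x H [tuple z i | i < n].
Proof.
move=> xy zx x0 hH.
have x_x : x \in interval1 x by rewrite in_interval1 x0 leqnn.
pose c0 : interval1 x := [` x_x].
have sub : interval1 x `<=` interval1 y.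
  apply/fsubsetP => a; rewrite !in_interval1 => /andP[-> ax].
  exact: leq_trans ax xy.
pose h (f : {ffun H -> interval1 x}) := [ffun c => fincl sub (f c)].
have h_inj : injective h.
  move=> f g /ffunP fg; apply/ffunP => c; apply: (fincl_inj (AsubB := sub)).
  by have := fg c; rewrite !ffunE.
have seq_h f : hand_seq n (h f) = hand_seq n f.
  apply/eq_from_tnth => i; rewrite !tnth_mktuple /card_value.
  by case: pickP => //= c _; rewrite ffunE.
rewrite /PF -[RHS](card_imset _ h_inj); apply: eq_card => g; rewrite inE.
apply/idP/imsetP => [gp|[f + ->]]; last by rewrite inE seq_h.
suff gx c : val (g c) \in interval1 x.
  exists [ffun c => [` gx c]]; last first.
    by apply/ffunP => c; rewrite !ffunE; exact/val_inj.
  rewrite inE -seq_h; suff -> : h [ffun c => [` gx c]] = g by [].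
  by apply/ffunP => c; rewrite !ffunE; exact/val_inj.
have := valP (g c); rewrite !in_interval1 => /andP[-> _] /=.
have [i ic] := hand_label c hH.
move: gp; rewrite (parking_hand_seq (fincl sub c0)) // => /parkingP/(_ n.-1).
have n0 : (0 < n)%N by apply: leq_ltn_trans (ltn_ord i).
rewrite card_ord ltn_predL prednK // => /(_ n0) cn.
have /setP/(_ i) : below val (label_colouring (fincl sub c0) n g) (z n.-1) = setT.
  by apply/eqP; rewrite eqEcard subsetT cardsT card_ord.
rewrite !inE (label_colouringE _ _ hH ic) => gz.
exact: leq_trans gz (zx _).
Qed.

Lemma parking_enum_widen x y n :
  (x <= y)%N -> (forall i, (z i <= x)%N) -> (0 < x)%N ->
  parking_enum y n = parking_enum x n.
Proof.
move=> xy zx x0; apply: eq_big_seq => H; rewrite in_hands is_handE => hH.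
by rewrite (PF_widen xy zx x0 hH).
Qed.

End ParkingEnumerator.

(** * The identity at every point, and Goncarov polynomials *)

(** The coefficients lie in a polynomial ring, so vanishing is tested on the
    coefficients of each monomial m in the y_t: they form a polynomial over K with
    infinitely many roots. *)
Lemma poly_eq0_of_natr (K : fieldType) (charK : [pchar K] =i pred0) (x : nat)
    (q : {poly ypoly K}) :
  (forall y, (x <= y)%N -> q.[y%:R] = 0) -> q = 0.
Proof.
move=> q0; apply/polyP => j; rewrite coef0; apply/malgP => m; rewrite mcoeff0.
pose qm := \poly_(i < size q) mcoeff m q`_i.
have qm_root y : (x <= y)%N -> root qm y%:R.
  move=> xy; rewrite /root horner_poly; apply/eqP.
  transitivity (mcoeff m q.[y%:R]); last by rewrite q0 // mcoeff0.
  rewrite horner_coef raddf_sum; apply: eq_bigr => i _.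
  by rewrite -!natrX !mulr_natr raddfMn.
have natr_inj : injective (fun i => (x + i)%:R : K).
  suff lt_neq a b : (a < b)%N -> a%:R != b%:R :> K.
    move=> a b /eqP; apply: contraTeq; rewrite neq_ltn => /orP[] ab.
      by rewrite lt_neq // ltn_add2l.
    by rewrite eq_sym lt_neq // ltn_add2l.
  move=> ab; rewrite eq_sym -subr_eq0 -natrB ?(ltnW ab) //.
  by rewrite (proj1 (pcharf0P _) charK) subn_eq0 -ltnNge.
have qm0 : qm = 0.
  apply/eqP; apply: contraT => qmN0.
  pose rs : seq K := [seq (x + i)%:R | i <- iota 0 (size qm)].
  have := @max_poly_roots _ qm rs qmN0; rewrite map_inj_uniq ?iota_uniq //.
  rewrite size_map size_iota ltnn => -> //.
  by apply/allP => _ /mapP[i _ ->]; apply: qm_root; exact: leq_addr.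
have := congr1 (fun p : {poly K} => p`_j) qm0; rewrite coef0 coef_poly.
by case: ltnP => // le_j _; rewrite nth_default ?mcoeff0.
Qed.

Section Goncarov.
Variables (K : fieldType) (charK : [pchar K] =i pred0).
Variables (P : choiceType) (F : exp_family P) (x : nat) (x_gt0 : (0 < x)%N).
Variables (z : nat -> nat) (z_homo : {homo z : i j / (i <= j)%N}).
Hypothesis z_le : forall i, (z i <= x)%N.

(** Both sides are polynomials in r; they agree at all large natural numbers,
    since the p_i computed with a larger set of values are the same. *)
Lemma type_enum_parking_at n (r : K) :
  (type_enum K F n).[r%:MP] =
    \sum_(i < n.+1) 'C(n, i)%:R *
      ((type_enum K F (n - i)).[(r - (z i)%:R)%:MP] * parking_enum K F z x i).
Proof.
pose q := type_enum K F n - \sum_(i < n.+1) 'C(n, i)%:R%:P *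
  ((type_enum K F (n - i) \Po ('X - (z i)%:R%:P)) * (parking_enum K F z x i)%:P).
have qE (s : ypoly K) : q.[s] = (type_enum K F n).[s] -
    \sum_(i < n.+1) 'C(n, i)%:R *
      ((type_enum K F (n - i)).[s - (z i)%:R] * parking_enum K F z x i).
  rewrite /q hornerD hornerN; congr (_ - _); rewrite horner_sum.
  apply: eq_bigr => i _.
  by rewrite !hornerM horner_comp !hornerE.
have q0 : q = 0.
  apply: (poly_eq0_of_natr charK (x := x)) => y xy; rewrite qE.
  rewrite (type_enum_parking _ _ z_homo) ?(leq_trans x_gt0) //.
  apply/eqP; rewrite subr_eq0; apply/eqP; apply: eq_bigr => i _.
  rewrite (parking_enum_widen K F i xy z_le x_gt0).
  rewrite natrB; first by [].
  exact: leq_trans (z_le i) xy.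
have /eqP := qE r%:MP; rewrite q0 horner0 eq_sym subr_eq0 => /eqP ->.
by apply: eq_bigr => i _; rewrite raddfB /= mpolyC_nat.
Qed.

(** With h_0 = 1, the identity above, solved for its last term, is the recursion
    defining the Goncarov polynomials. *)
Lemma goncarov_parking n (r : K) (U : nat -> K) :
  (forall i, (i < n)%N -> U i = r - (z i)%:R) ->
  (goncarov F U n).[r%:MP] = parking_enum K F z x n.
Proof.
elim/ltn_ind: n => n IHn UE.
rewrite goncarovE hornerD hornerN type_enum_parking_at horner_sum big_ord_recr.
rewrite /= subnn type_enum0 binn hornerC !mul1r addrAC.
rewrite -[RHS]add0r; congr (_ + _); apply/eqP; rewrite subr_eq0; apply/eqP.
apply: eq_bigr => i _; rewrite hornerZ (UE i (ltn_ord i)) mulrA.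
congr (_ * _); symmetry; apply: (IHn i (ltn_ord i)) => // j ji.
exact/UE/(ltn_trans ji).
Qed.

End Goncarov.

Theorem theorem6 (K : fieldType) (charK : [pchar K] =i pred0)
    (P : choiceType) (F : exp_family P) (n x : nat) (x_gt0 : (0 < x)%N)
    (Z : nat -> K) (z : n.-tuple nat)
    (Zz : forall i : 'I_n, Z i = (tnth z i)%:R)
    (zX : forall i : 'I_n, tnth z i \in interval1 x)
    (z_le : sorted leq z) :
  (goncarov F (fun i => - Z i) n).[0] =
    (goncarov F (fun i => x%:R - Z i) n).[x%:R] /\
  (goncarov F (fun i => x%:R - Z i) n).[x%:R] =
    \sum_(H <- hands F n) hand_type K H * (PF x H z)%:R.
Proof.
(* The default x keeps the extended sequence nondecreasing and bounded by x. *)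
pose zx i := nth x z i.
have zx_le i : (zx i <= x)%N.
  have [ltin|leni] := ltnP i n; last by rewrite /zx nth_default ?size_tuple.
  have := zX (Ordinal ltin).
  by rewrite in_interval1 (tnth_nth x) => /andP[].
have zx_homo : {homo zx : i j / (i <= j)%N}.
  move=> i j leij; have [ltjn|lenj] := ltnP j n; last first.
    by rewrite {2}/zx nth_default ?size_tuple.
  apply: (sorted_leq_nth leq_trans leqnn) => //.
    by rewrite inE size_tuple (leq_ltn_trans leij).
  by rewrite inE size_tuple.
have ZE i : (i < n)%N -> Z i = (zx i)%:R.
  by move=> ltin; rewrite (Zz (Ordinal ltin)) (tnth_nth x).
have -> : \sum_(H <- hands F n) hand_type K H * (PF x H z)%:R =
    parking_enum K F zx x n.
  suff -> : z = [tuple zx i | i < n] by [].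
  by apply/eq_from_tnth => i; rewrite tnth_mktuple (tnth_nth x).
rewrite -malgC0E -mpolyC_nat.
by split; [transitivity (parking_enum K F zx x n); [|symmetry]|];
  apply: goncarov_parking => // i ltin; rewrite ZE // ?sub0r.
Qed.
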